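(* Let $(M,g)$ be a smooth, connected, compact Riemannian manifold without boundary, of dimension $n\ge 2$, whose sectional curvature satisfies $-\frac{n}{n-1}\beta<\sec\le-\beta<0$ for some real number $\beta>0$. Then for every $p\ge 2$ the Sampson Laplacian $\Delta_S:C^\infty(S_0^pM)\to C^\infty(S_0^pM)$ satisfies $\dim_{\mathbb{R}}\mathrm{Ker}\,\Delta_S=0$.
   Context: $S_0^pM$ is the bundle of symmetric covariant $p$-tensors on $M$ that are totally traceless (the $g$-trace over any pair of indices vanishes). The sign convention for the curvature tensor $R_{ijkl}$ is such that $\sec(X,Y)=R(X,Y,X,Y)$ for orthonormal $X,Y$, and the Ricci tensor is $R_{kl}=R^i{}_{kil}$. The Sampson Laplacian is $\Delta_S=\bar\Delta-\mathfrak{R}_p$, where $\bar\Delta=\nabla^*\nabla$ is the rough Laplacian ($\nabla$ the Levi-Civita connection, $\nabla^*$ its formal $L^2$-adjoint) and $\mathfrak{R}_p$ is the Weitzenböck curvature operator $$\mathfrak{R}_p(\varphi)_{i_1\ldots i_p}=\sum_{a=1}^{p}g^{jk}R_{i_aj}\,\varphi_{i_1\ldots i_{a-1}k\,i_{a+1}\ldots i_p}-\sum_{a\ne b}g^{jk}g^{lm}R_{i_aj\,i_bl}\,\varphi_{i_1\ldots k\ldots m\ldots i_p},$$ where in the second sum $k$ stands in position $a$ and $m$ in position $b$. (Equivalently $\Delta_S=\delta\delta^*-\delta^*\delta$ on symmetric tensors, where $\delta$ is the divergence and $\delta^*=(p+1)\,\mathrm{Sym}\circ\nabla$ on symmetric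 $p$-tensors.) $\mathrm{Ker}\,\Delta_S$ is the space of smooth sections $\varphi$ of $S_0^pM$ with $\Delta_S\varphi=0$. Inequalities on $\sec$ are meant for all tangent $2$-planes at all points. *)

(* Defs.v *)
From HB Require Import structures.
From mathcomp Require Import all_boot all_order all_algebra perm.
From mathcomp Require Import all_classical all_reals all_analysis.

Set Implicit Arguments.
Unset Strict Implicit.
Unset Printing Implicit Defensive.

Import Order.TTheory GRing.Theory Num.Theory.
Import numFieldNormedType.Exports.

Local Open Scope classical_set_scope.
Local Open Scope ring_scope.

Definition has_dim (R : realType) (V : lmodType R) (K : set V) (d : nat) : Prop :=
  exists b : 'I_d -> V,
    (forall a : 'I_d -> R, \sum_i a i *: b i = 0 -> forall i, a i = 0) /\
    K = [set v | exists a : 'I_d -> R, v = \sum_i a i *: b i].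

(* [C^k] on an open set [U] of R^n, through iterated partial derivatives. *)
Fixpoint Ck (R : realType) (n k : nat) (U : set 'rV[R]_n)
    (f : 'rV[R]_n -> R^o) : Prop :=
  (forall y, U y -> {for y, continuous f}) /\
  (if k is k'.+1 then
     forall i : 'I_n, (forall y, U y -> derivable f y (delta_mx 0 i)) /\
       Ck k' U (fun y => 'D_(delta_mx 0 i) f y)
   else True).

(* A homeomorphism [crd] from the open set [cdom] of [M] onto an open set of R^n;
   [crdV] is its inverse, with irrelevant values outside [crd @` cdom]. *)
Record chart (R : realType) (n : nat) (M : topologicalType) := Chart {
  cdom : set M;
  crd : M -> 'rV[R]_n;
  crdV : 'rV[R]_n -> M;
  cdom_open : open cdom;
  img_open : open (crd @` cdom);
  crdK : forall x, cdom x -> crdV (crd x) = x;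
  crd_cont : forall x, cdom x -> {for x, continuous crd};
  crdV_cont : forall y, (crd @` cdom) y -> {for y, continuous crdV} }.

Definition smooth_on (R : realType) (n : nat) (M : topologicalType)
    (c : chart R n M) (D : set M) (f : M -> R^o) : Prop :=
  forall k, Ck k (crd c @` D) (f \o crdV c).

Definition pd (R : realType) (n : nat) (M : topologicalType)
    (c : chart R n M) (i : 'I_n) (f : M -> R^o) (x : M) : R :=
  'D_(delta_mx 0 i) (f \o crdV c) (crd c x).

Record manifold (R : realType) (n : nat) (M : topologicalType) := Manifold {
  M_hausdorff : hausdorff_space M;
  M_countable : @second_countable M;
  idx : Type;
  chart_ : idx -> chart R n M;
  chart_cover : forall x, exists c, cdom (chart_ c) x;
  chart_compat : forall (c c' : idx) (j : 'I_n),
    smooth_on (chart_ c) (cdom (chart_ c) `&` cdom (chart_ c'))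
              (fun x => crd (chart_ c') x 0 j) }.

Section Manifold.
Context {R : realType} {n : nat} {M : topologicalType} (A : manifold R n M).

Definition jac (c c' : idx A) (x : M) : 'M[R]_n :=
  \matrix_(k, i) pd (chart_ c) i (fun y => crd (chart_ c') y 0 k) x.

Definition chart_at (x : M) : idx A := projT1 (cid (chart_cover A x)).

Local Notation mindex p := {ffun 'I_p -> 'I_n}.

(* [T c x I] is the component [T_{I 0 ... I (p-1)}] at [x] in the chart [c]. *)
Definition tfield (p : nat) : lmodType R := idx A -> M -> mindex p -> R^o.

(* Components outside the domain of a chart are meaningless; they are set to 0
   so that equal sections are equal families. *)
Definition smooth_section (p : nat) (T : tfield p) : Prop :=
  [/\ forall c x, ~ cdom (chart_ c) x -> T c x = 0,
      forall c I, smooth_on (chart_ c) (cdom (chart_ c)) (fun x => T c x I) &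
      forall c c' x, cdom (chart_ c) x -> cdom (chart_ c') x ->
        forall I, T c x I =
          \sum_(K : mindex p) (\prod_a jac c c' x (K a) (I a)) * T c' x K].

Definition upd (p : nat) (I : mindex p) (a : 'I_p) (k : 'I_n) : mindex p :=
  [ffun b => if b == a then k else I b].

Record riem_metric := RiemMetric {
  gmx : idx A -> M -> 'M[R]_n;
  g_smooth : forall c i j,
    smooth_on (chart_ c) (cdom (chart_ c)) (fun x => gmx c x i j);
  g_tensor : forall c c' x, cdom (chart_ c) x -> cdom (chart_ c') x ->
    gmx c x = (jac c c' x)^T *m gmx c' x *m jac c c' x;
  g_sym : forall c x, cdom (chart_ c) x -> (gmx c x)^T = gmx c x;
  g_pos : forall c x, cdom (chart_ c) x ->
    forall v : 'rV[R]_n, v != 0 -> 0 < (v *m gmx c x *m v^T) 0 0 }.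

End Manifold.

Section Riemannian.
Context {R : realType} {n : nat} {M : topologicalType} {A : manifold R n M}.
Local Notation mindex p := {ffun 'I_p -> 'I_n}.
Variable g : riem_metric A.
Implicit Types (c : idx A) (x : M).

Definition ginv c x : 'M[R]_n := invmx (gmx g c x).

(* [christoffel c k i j] is Gamma^k_{ij}. *)
Definition christoffel c (k i j : 'I_n) x : R :=
  2^-1 * \sum_l ginv c x k l *
    (pd (chart_ c) i (fun y => gmx g c y j l) x
     + pd (chart_ c) j (fun y => gmx g c y i l) x
     - pd (chart_ c) l (fun y => gmx g c y i j) x).

(* [curv13 c l k i j] is the d_l component of [R(d_i, d_j) d_k], where
   [R(X, Y) = [nabla_X, nabla_Y] - nabla_[X, Y]]. *)
Definition curv13 c (l k i j : 'I_n) x : R :=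
  pd (chart_ c) i (christoffel c l j k) x
  - pd (chart_ c) j (christoffel c l i k) x
  + \sum_m (christoffel c l i m x * christoffel c m j k x
            - christoffel c l j m x * christoffel c m i k x).

(* [R_{ijkl} = g(R(d_i, d_j) d_l, d_k)], so that [R_{ijij}] is positive on round
   spheres. *)
Definition riem c (i j k l : 'I_n) x : R :=
  \sum_m gmx g c x k m * curv13 c m l i j x.

Definition ricci c (k l : 'I_n) x : R :=
  \sum_i \sum_m ginv c x i m * riem c m k i l x.

Definition gdot c x (X Y : 'rV[R]_n) : R := (X *m gmx g c x *m Y^T) 0 0.

Definition orthonormal_pair c x (X Y : 'rV[R]_n) : Prop :=
  [/\ gdot c x X X = 1, gdot c x Y Y = 1 & gdot c x X Y = 0].

(* Sectional curvature of the plane spanned by an orthonormal pair. *)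
Definition sec c x (X Y : 'rV[R]_n) : R :=
  \sum_i \sum_j \sum_k \sum_l
    riem c i j k l x * X 0 i * Y 0 j * X 0 k * Y 0 l.

Section Tensors.
Variable p : nat.
Implicit Types T S phi : tfield A p.

(* [C^infty(S_0^p M)] *)
Definition sym_traceless : set (tfield A p) := [set T |
  [/\ smooth_section T,
      forall c x, cdom (chart_ c) x -> forall (s : 'S_p) (I : mindex p),
        T c x [ffun a => I (s a)] = T c x I &
      forall c x, cdom (chart_ c) x -> forall (a b : 'I_p) (I : mindex p),
        a != b ->
        \sum_k \sum_l ginv c x k l * T c x (upd (upd I a k) b l) = 0]].

(* Levi-Civita covariant derivative; the differentiation index comes first. *)
Definition nabla T : tfield A p.+1 := fun c x K =>
  if pselect (cdom (chart_ c) x) then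
    let I : mindex p := [ffun a => K (lift ord0 a)] in
    pd (chart_ c) (K ord0) (fun y => T c y I) x
    - \sum_a \sum_m christoffel c m (K ord0) (I a) x * T c x (upd I a m)
  else 0.

Definition weitzenbock phi : tfield A p := fun c x I =>
  \sum_a \sum_j \sum_k ginv c x j k * ricci c (I a) j x * phi c x (upd I a k)
  - \sum_a \sum_(b | b != a) \sum_j \sum_k \sum_l \sum_m
      ginv c x j k * ginv c x l m * riem c (I a) j (I b) l x
      * phi c x (upd (upd I a k) b m).

(* Pointwise inner product: full contraction with the metric; for tensor fields
   the value does not depend on the chart. *)
Definition tdot T S x : R :=
  let c := chart_at A x in
  \sum_(I : mindex p) \sum_(J : mindex p)
    (\prod_a ginv c x (I a) (J a)) * T c x I * S c x J.

End Tensors.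
End Riemannian.

Definition borel (T : ptopologicalType) := g_sigma_algebraType (@open T).

Definition is_lebesgue (R : realType) (n : nat)
    (lam : {measure set (borel 'rV[R]_n) -> \bar R}) : Prop :=
  forall a b : 'rV[R]_n, (forall i, a 0 i <= b 0 i) ->
    lam [set y : 'rV[R]_n | forall i, a 0 i < y 0 i <= b 0 i]
    = (\prod_i (b 0 i - a 0 i))%:E.

(* The Borel measure given by [sqrt (det g) dx] in every chart. *)
Definition riemannian_volume (R : realType) (n : nat) (M : ptopologicalType)
    (A : manifold R n M) (g : riem_metric A)
    (vol : {measure set (borel M) -> \bar R}) : Prop :=
  exists lam : {measure set (borel 'rV[R]_n) -> \bar R},
    is_lebesgue lam /\
    forall (c : idx A) (B : set (borel M)),
      measurable B -> B `<=` cdom (chart_ c) ->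
      vol B = (\int[lam]_(y in crd (chart_ c) @` B)
                 (Num.sqrt (\det (gmx g c (crdV (chart_ c) y))))%:E)%E.

Section Sampson.
Context {R : realType} {n : nat} {M : ptopologicalType} {A : manifold R n M}.
Variables (g : riem_metric A) (vol : {measure set (borel M) -> \bar R}).

Definition l2dot (p : nat) (T S : tfield A p) : \bar R :=
  (\int[vol]_x (tdot g T S x)%:E)%E.

(* Formal L^2-adjoint of [nabla : C^infty(S_0^p) -> C^infty(T^* (x) S_0^p)]:
   the section [psi] of [S_0^p] such that [<T, psi> = <nabla T, S>] for all [T]
   (0 if there were none). *)
Definition nabla_star (p : nat) (S : tfield A p.+1) : tfield A p :=
  xget 0 [set psi | sym_traceless g psi /\
    forall T, sym_traceless g T -> l2dot T psi = l2dot (nabla g T) S].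

Definition rough_laplacian (p : nat) (phi : tfield A p) : tfield A p :=
  nabla_star (nabla g phi).

Definition sampson_laplacian (p : nat) (phi : tfield A p) : tfield A p :=
  rough_laplacian phi - weitzenbock g phi.

Definition ker_sampson (p : nat) : set (tfield A p) :=
  [set phi | sym_traceless g phi /\ sampson_laplacian phi = 0].

End Sampson.

Arguments ker_sampson {R n M A} g vol p _.

(* Main.v *)
Require Import Defs.
From HB Require Import structures.
From mathcomp Require Import all_boot all_order all_algebra perm complex.
From mathcomp Require Import all_classical all_reals all_analysis.
From mathcomp Require Import ring lra.

(** Let [phi] be in the kernel and write [W phi] for its Weitzenbock term. Either
    no formal adjoint of [nabla phi] exists and [W phi = 0], or [W phi] is that
    adjoint and [<phi, W phi> = |nabla phi|^2 >= 0] in L^2; integration by parts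
    itself is thus part of the definition of [nabla_star]. It remains to show that
    the pointwise form [<phi, W phi>] is negative wherever [phi <> 0].

    In an orthonormal frame the Ricci terms contribute at most
    [- p (n - 1) beta |phi|^2]. For each pair of slots the slices of [phi] are
    symmetric traceless matrices [S]; in an eigenbasis of [S], with eigenvalues
    [d_a] and sectional curvatures [K_ab = - beta (1 + t_ab)], [0 <= t_ab < 1/(n-1)],
    [\sum_(a != b) K_ab d_a d_b >= beta (|d|^2 - \sum_(a != b) |d_a d_b| / (n-1)) >= 0]
    because [\sum_a d_a = 0] and [\sum_(a != b) |d_a d_b| <= (n - 1) |d|^2].
    Only values of the curvature form on orthonormal pairs occur, so beyond the
    antisymmetry in the first two indices no curvature identity is needed. *)

Set Implicit Arguments.
Unset Strict Implicit.
Unset Printing Implicit Defensive.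

Import Order.TTheory GRing.Theory Num.Theory.
Import numFieldNormedType.Exports.

Local Open Scope classical_set_scope.
Local Open Scope ring_scope.

(** * Simultaneous diagonalization *)

Definition posdef (R : numDomainType) n (G : 'M[R]_n) :=
  forall v : 'rV_n, v != 0 -> 0 < (v *m G *m v^T) 0 0.

Lemma posdef_unit (R : numFieldType) n (G : 'M[R]_n) :
  posdef G -> G \in unitmx.
Proof.
move=> Gpos; rewrite -row_free_unit -kermx_eq0; apply/rowV0P => v /sub_kermxP vG.
by apply/eqP/negP => /negP /Gpos; rewrite vG mul0mx mxE ltxx.
Qed.

(* The pencil has a complex eigenvector [x + i y]; pairing its real and
   imaginary parts shows that the eigenvalue is real, so [x] or [y] will do. *)
Lemma sym_pencil_eigen (R : rcfType) n (G S : 'M[R]_n.+1) :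
  G^T = G -> S^T = S -> posdef G ->
  exists a (v : 'rV_n.+1), v != 0 /\ v *m S = a *: (v *m G).
Proof.
move=> Gs Ss Gpos; have Gu := posdef_unit Gpos.
pose toC := real_complex R.
have [a /eigenvalueP[v vA v0]] :=
  eigenvalue_closed (map_mx toC (S *m invmx G)) (ltn0Sn n).
pose x := map_mx (@complex.Re R) v; pose y := map_mx (@complex.Im R) v.
have ReM (B : 'M[R]_n.+1) : map_mx (@complex.Re R) (v *m map_mx toC B) = x *m B.
  apply/rowP => j; rewrite !mxE raddf_sum; apply: eq_bigr => k _.
  by rewrite !mxE /toC; case: (v 0 k) => r i /=; rewrite mulr0 subr0.
have ImM (B : 'M[R]_n.+1) : map_mx (@complex.Im R) (v *m map_mx toC B) = y *m B.
  apply/rowP => j; rewrite !mxE raddf_sum; apply: eq_bigr => k _.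
  by rewrite !mxE /toC; case: (v 0 k) => r i /=; rewrite mulr0 add0r.
have vS : v *m map_mx toC S = a *: (v *m map_mx toC G).
  by rewrite scalemxAl -vA -mulmxA -map_mxM mulmxKV.
case: a vA vS => [al be] _ vS.
have xS : x *m S = al *: (x *m G) - be *: (y *m G).
  by rewrite -!ReM -ImM vS; apply/rowP => j; rewrite !mxE; case: (\sum_(_ | _) _).
have yS : y *m S = al *: (y *m G) + be *: (x *m G).
  by rewrite -!ImM -ReM vS; apply/rowP => j; rewrite !mxE; case: (\sum_(_ | _) _).
have symf (B : 'M[R]_n.+1) (z w : 'rV_n.+1) : B^T = B ->
    (z *m B *m w^T) 0 0 = (w *m B *m z^T) 0 0.
  move=> Bs; have -> : z *m B *m w^T = (w *m B *m z^T)^T.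
    by rewrite !trmx_mul trmxK Bs mulmxA.
  by rewrite mxE.
have eD (B B' : 'M[R]_1) : (B + B') 0 0 = B 0 0 + B' 0 0 by rewrite mxE.
have eN (B : 'M[R]_1) : (- B) 0 0 = - B 0 0 by rewrite mxE.
have eZ c (B : 'M[R]_1) : (c *: B) 0 0 = c * B 0 0 by rewrite mxE.
have be0 : be * ((x *m G *m x^T) 0 0 + (y *m G *m y^T) 0 0) = 0.
  have := symf S x y Ss; rewrite xS yS !mulmxDl mulNmx -!scalemxAl !eD eN !eZ.
  by rewrite (symf G x y Gs); lra.
(* When [x = 0] the term [be *: (x *m G)] of [yS] drops out, so [y] is an eigenvector directly;
   otherwise positivity of [G] forces [be = 0]. *)
have [x0|x0] := eqVneq x 0; last first.
  have be_eq0 : be = 0.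
    apply/eqP; move/eqP: be0; rewrite mulf_eq0 => /orP[//|].
    have [->|y0] := eqVneq y 0.
      by rewrite mul0mx mul0mx [X in _ + X]mxE addr0 gt_eqF ?Gpos.
    by rewrite gt_eqF // addr_gt0 ?Gpos.
  by exists al, x; split=> //; rewrite xS be_eq0 scale0r subr0.
exists al, y; split; last by rewrite yS x0 mul0mx scaler0 addr0.
apply: contraNneq v0 => y0; apply/eqP/rowP => j; move: x0 y0.
move=> /rowP/(_ j) + /rowP/(_ j); rewrite !mxE.
by case: (v 0 j) => r i /= -> ->.
Qed.

(** Induction on the dimension: an eigenvector [v] of the pencil, normalized for [G], is split off.
    The rows of [B] span its [G]-orthogonal complement, which is also [S]-orthogonal to [v] because
    [v *m S] is a multiple of [v *m G]; both forms thus become block diagonal. *)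
Lemma posdef_codiag (R : rcfType) n (G S : 'M[R]_n) :
  G^T = G -> S^T = S -> posdef G ->
  exists (P : 'M[R]_n) (d : 'rV[R]_n),
    P *m G *m P^T = 1%:M /\ P *m S *m P^T = diag_mx d.
Proof.
elim: n G S => [|n IHn] G S Gs Ss Gpos.
  by exists 1%:M, 0; split; apply/matrixP => -[].
have [a [w [w0 wS]]] := sym_pencil_eigen Gs Ss Gpos.
have wG := Gpos w w0.
pose s := Num.sqrt ((w *m G *m w^T) 0 0); have s0 : 0 < s by rewrite sqrtr_gt0.
pose v := s^-1 *: w.
have vS : v *m S = a *: (v *m G).
  by rewrite -!scalemxAl wS !scalerA mulrC.
have vG : v *m G *m v^T = 1%:M.
  rewrite [LHS]mx11_scalar /v linearZ /= -!scalemxAl -scalemxAr scalerA.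
  rewrite [(_ *: _ : 'M[R]_1) 0 0]mxE -invfM -expr2 sqr_sqrtr ?ltW// mulVf//.
  by rewrite gt_eqF.
(* The complement has dimension [n] only by a rank count; naming the dimension [m] and substituting
   gives [B] the type that the induction hypothesis expects. *)
have [m [mn [B [Bfree Bv]]]] : exists m, m = n /\
    exists B : 'M[R]_(m, n.+1), row_free B /\ B *m (v *m G)^T = 0.
  exists (\rank (kermx (v *m G)^T)); split.
    rewrite mxrank_ker mxrank_tr rank_rV.
    have -> : v *m G != 0.
      apply: contra_eq_neq vG => ->; rewrite mul0mx.
      by apply/eqP => /matrixP/(_ 0 0)/eqP; rewrite !mxE eqxx eq_sym oner_eq0.
    by rewrite subn1.
  exists (row_base (kermx (v *m G)^T)); split; first exact: row_base_free.
  by apply/sub_kermxP; rewrite eq_row_base.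
subst m.
have [P [d [PG PS]]] : exists (P : 'M[R]_n) (d : 'rV[R]_n),
    P *m (B *m G *m B^T) *m P^T = 1%:M /\ P *m (B *m S *m B^T) *m P^T = diag_mx d.
  apply: IHn; rewrite ?trmx_mul ?trmxK ?Gs ?Ss ?mulmxA// => u u0.
  have := Gpos (u *m B); rewrite mulmx_free_eq0// => /(_ u0).
  by rewrite trmx_mul !mulmxA.
have BGv : B *m G *m v^T = 0 by move: Bv; rewrite trmx_mul Gs mulmxA.
have vGB : v *m G *m B^T = 0.
  by apply: trmx_inj; rewrite !trmx_mul trmxK Gs mulmxA BGv trmx0.
have BSv : B *m S *m v^T = 0.
  by rewrite -mulmxA -{1}Ss -trmx_mul vS linearZ /= -scalemxAr Bv scaler0.
have vSB : v *m S *m B^T = 0 by rewrite vS -scalemxAl vGB scaler0.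
have blockE (H : 'M[R]_n.+1) : let V : 'M[R]_(1 + n, n.+1) := col_mx v (P *m B) in
    V *m H *m V^T = block_mx (v *m H *m v^T) (v *m H *m B^T *m P^T)
      (P *m (B *m H *m v^T)) (P *m (B *m H *m B^T) *m P^T) :> 'M[R]_(1 + n).
  by move=> V; rewrite mul_col_mx tr_col_mx mul_col_row trmx_mul !mulmxA.
exists (col_mx v (P *m B) : 'M[R]_(1 + n, n.+1)).
exists (row_mx (a%:M : 'M[R]_1) d : 'rV_(1 + n)).
split; apply: etrans (blockE _) _.
  by rewrite vG vGB BGv PG mul0mx mulmx0 -scalar_mx_block.
apply: etrans (esym (diag_mx_row _ _)).
rewrite vSB BSv PS mul0mx mulmx0 vS -scalemxAl vG; congr block_mx.
by apply/matrixP => i j; rewrite !ord1 !mxE eqxx !mulr1n mulr1.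
Qed.

(** The case [G = 1], written as a sum of rank-one matrices so that [biq_sum] can expand curvature
    forms over an eigenbasis. *)
Lemma sym_spectral (R : rcfType) n (S : 'M[R]_n) : S^T = S ->
  exists (P : 'M[R]_n) (d : 'rV[R]_n),
    P *m P^T = 1%:M /\ S = \sum_a d 0 a *: ((row a P)^T *m row a P).
Proof.
move=> Ss; have [||P [d [PP PS]]] := @posdef_codiag R n 1%:M S _ Ss.
- by rewrite trmx1.
- move=> v v0; rewrite mulmx1 mxE; rewrite lt_neqAle sumr_ge0; last first.
    by move=> i _; rewrite mxE -expr2 sqr_ge0.
  rewrite andbT eq_sym; apply: contraNneq v0 => /psumr_eq0P vi0.
  apply/eqP/rowP => i; apply/eqP; rewrite mxE -sqrf_eq0 expr2.
  by have := vi0 _ i; rewrite mxE => -> // j _; rewrite mxE -expr2 sqr_ge0.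
rewrite mulmx1 in PP; exists P, d; split=> //.
have PtP : P^T *m P = 1%:M by apply: mulmx1C.
have -> : S = P^T *m diag_mx d *m P.
  by rewrite -PS !mulmxA PtP mul1mx -mulmxA PtP mulmx1.
apply/matrixP => i j; rewrite summxE !mxE; apply: eq_bigr => a _.
rewrite mul_mx_diag !mxE big_ord_recl big_ord0 !mxE; ring.
Qed.

(** * Biquadratic curvature forms and their pinching estimates *)

Section Biquadratic.
Variables (R : realFieldType) (n : nat) (K : 'I_n -> 'I_n -> 'I_n -> 'I_n -> R).

(** On [X^T *m X] and [Y^T *m Y] this is [K(X, Y, X, Y)], a sectional curvature when the pair is
    orthonormal. [A = 1] gives the Ricci form, and [A = B] the curvature action on symmetric
    2-tensors. *)
Definition biq (A B : 'M[R]_n) : R :=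
  \sum_i \sum_j \sum_k \sum_l K i j k l * A i k * B j l.

Lemma biq_sum (I J : finType) (a : I -> R) (b : J -> R) (F : I -> 'M[R]_n)
    (H : J -> 'M[R]_n) :
  biq (\sum_x a x *: F x) (\sum_y b y *: H y) =
  \sum_x \sum_y a x * b y * biq (F x) (H y).
Proof.
have sum4 (f : 'I_n -> 'I_n -> 'I_n -> 'I_n -> R) :
    \sum_i \sum_j \sum_k \sum_l f i j k l =
    \sum_(q : 'I_n * 'I_n * 'I_n * 'I_n) f q.1.1.1 q.1.1.2 q.1.2 q.2.
  by rewrite !pair_bigA.
rewrite /biq sum4.
under [RHS]eq_bigr do under eq_bigr do rewrite sum4 mulr_sumr.
under [RHS]eq_bigr do rewrite exchange_big.
rewrite [RHS]exchange_big; apply: eq_bigr => q _ /=.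
rewrite !summxE -mulrA big_distrlr mulr_sumr; apply: eq_bigr => x _ /=.
rewrite mulr_sumr; apply: eq_bigr => y _; rewrite !mxE; ring.
Qed.

End Biquadratic.

Lemma row_orthonormal (R : comPzRingType) n (P : 'M[R]_n) i j :
  P *m P^T = 1%:M -> row i P *m (row j P)^T = (i == j)%:R%:M.
Proof.
move=> PP; apply/matrixP => k l; rewrite !ord1 tr_row colE mulmxA -row_mul PP.
by rewrite -colE !mxE mulr1n.
Qed.

(* In an orthonormal eigenbasis only the values of the form on orthonormal pairs
   enter. *)
Section Pinched.
Variables (R : rcfType) (n : nat) (K : 'I_n -> 'I_n -> 'I_n -> 'I_n -> R).
Hypothesis n_gt1 : (1 < n)%N.
Variable beta : R.
Hypothesis K_diag : forall X : 'rV[R]_n, biq K (X^T *m X) (X^T *m X) = 0.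
Hypothesis K_pinched : forall X Y : 'rV[R]_n,
  X *m X^T = 1%:M -> Y *m Y^T = 1%:M -> X *m Y^T = 0 ->
  - (n%:R / (n%:R - 1)) * beta < biq K (X^T *m X) (Y^T *m Y) <= - beta.

Lemma pinched_rows (P : 'M[R]_n) a b : P *m P^T = 1%:M -> a != b ->
  - (n%:R / (n%:R - 1)) * beta <
    biq K ((row a P)^T *m row a P) ((row b P)^T *m row b P) <= - beta.
Proof.
move=> PP /negPf ab.
by apply: K_pinched; rewrite row_orthonormal// ?eqxx// ab raddf0.
Qed.

Lemma mxtrace_spectral (P : 'M[R]_n) (d : 'rV[R]_n) : P *m P^T = 1%:M ->
  \tr (\sum_a d 0 a *: ((row a P)^T *m row a P)) = \sum_a d 0 a.
Proof.
move=> PP; rewrite raddf_sum; apply: eq_bigr => a _ /=.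
by rewrite mxtraceZ mxtrace_mulC row_orthonormal// eqxx mxtrace1 mulr1.
Qed.

Lemma pinched_trace0 (S : 'M[R]_n) : S^T = S -> \tr S = 0 -> 0 <= biq K S S.
Proof.
have n1 : 0 < n%:R - 1 :> R by rewrite subr_gt0 ltr1n.
move=> /sym_spectral[P [d [PP ->]]]; rewrite mxtrace_spectral// => d0.
(* [c] is the width of the pinching interval: [n / (n - 1) * beta = beta + c]. *)
rewrite biq_sum; pose c := beta / (n%:R - 1).
have cE : c * (n%:R - 1) = beta by rewrite divfK ?gt_eqF.
(* For [a != b], [f a b] is a lower bound of the summand, by [|d_a d_b| <= (d_a^2 + d_b^2) / 2]; the
   extra diagonal term makes [f a a = 0]. As the [d_a] sum to 0, the total is
   [(beta + c - n c) |d|^2], which vanishes by the choice of [c]. *)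
pose f a b : R := - beta * (d 0 a * d 0 b) - c / 2 * (d 0 a ^+ 2 + d 0 b ^+ 2)
  + (if b == a then (beta + c) * d 0 a ^+ 2 else 0).
suff fE : \sum_a \sum_b f a b = 0.
  rewrite -[X in X <= _]fE; apply: ler_sum => a _; apply: ler_sum => b _; rewrite /f.
  have [<-|ba] := eqVneq b a; first by rewrite K_diag; lra.
  rewrite eq_sym in ba; have := pinched_rows PP ba; set k := biq _ _ _.
  have -> : - (n%:R / (n%:R - 1)) * beta = - (beta + c).
    by rewrite /c; field; rewrite gt_eqF.
  by have := sqr_ge0 (d 0 a + d 0 b); have := sqr_ge0 (d 0 a - d 0 b); nra.
have rowE a : \sum_b f a b = (beta + c) * d 0 a ^+ 2
    - c / 2 * (n%:R * d 0 a ^+ 2 + \sum_b d 0 b ^+ 2).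
  rewrite /f !big_split -big_mkcond big_pred1_eq sumrN -!mulr_sumr d0 big_split/=.
  by rewrite sumr_const card_ord -[d 0 a ^+ 2 *+ n]mulr_natl !mulr0 add0r addrC.
under eq_bigr do rewrite rowE.
rewrite big_split sumrN -!mulr_sumr big_split/= -mulr_sumr sumr_const card_ord.
by rewrite -[_ *+ n]mulr_natl -cE; field.
Qed.

(** In an eigenbasis of [S] each eigenvalue is nonnegative and is weighted by [n - 1] sectional
    curvatures, all at most [- beta]; the diagonal value is 0 by [K_diag]. *)
Lemma pinched_psd (S : 'M[R]_n) : S^T = S ->
    (forall v : 'rV_n, 0 <= (v *m S *m v^T) 0 0) ->
  biq K 1%:M S <= - beta * (n%:R - 1) * \tr S.
Proof.
move=> /sym_spectral[P [d [PP SE]]] S_ge0.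
have d_ge0 b : 0 <= d 0 b.
  have := S_ge0 (row b P); rewrite SE mulmx_sumr mulmx_suml summxE (bigD1 b)//=.
  rewrite -scalemxAr -scalemxAl !mulmxA row_orthonormal// eqxx mul1mx.
  rewrite row_orthonormal// eqxx big1 ?addr0 => [|a ab].
    by rewrite !mxE mulr1.
  rewrite -scalemxAr -scalemxAl mulmxA row_orthonormal// eq_sym (negPf ab).
  by rewrite raddf0 !mul0mx scaler0 mxE.
have -> : 1%:M = \sum_a 1 *: ((row a P)^T *m row a P).
  have PtP : P^T *m P = 1%:M by apply: mulmx1C.
  rewrite -PtP; apply/matrixP => i j; rewrite summxE !mxE; apply: eq_bigr => a _.
  by rewrite !mxE big_ord_recl big_ord0 !mxE mul1r addr0.
rewrite SE mxtrace_spectral// biq_sum exchange_big mulr_sumr; apply: ler_sum => b _.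
rewrite (bigD1 b)//= K_diag mulr0 add0r.
have -> : - beta * (n%:R - 1) * d 0 b = \sum_(a | a != b) d 0 b * - beta.
  rewrite sumr_const cardC1 card_ord -[n in n.-1]prednK ?(ltnW n_gt1)//.
  rewrite -mulr_natr -{1}(prednK (ltnW n_gt1)) -natr1; ring.
apply: ler_sum => a ab; rewrite mul1r ler_wpM2l//.
by have /andP[] := pinched_rows PP ab.
Qed.

End Pinched.

(** * Tensor components *)

Section TensorAction.
Variables (R : comPzRingType) (n p : nat).
Local Notation mindex := {ffun 'I_p -> 'I_n}.
Implicit Types (F G : 'I_p -> 'M[R]_n) (T S : mindex -> R) (I J K : mindex).

(** A tensor product of matrices, one per slot. Frame changes, index raising and operators on one or
    two slots all have this form, so identities between them reduce to matrix identities slot by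
    slot. *)
Definition tact F T : mindex -> R :=
  fun I => \sum_(K : mindex) (\prod_a F a (I a) (K a)) * T K.

Lemma eq_tact F G T S : F =1 G -> T =1 S -> tact F T =1 tact G S.
Proof.
move=> FG TS I; apply: eq_bigr => K _; rewrite TS; congr (_ * _).
by apply: eq_bigr => a _; rewrite FG.
Qed.

Lemma tact_comp F G T : tact F (tact G T) =1 tact (fun a => F a *m G a) T.
Proof.
move=> I; rewrite /tact.
under eq_bigr do rewrite mulr_sumr; rewrite exchange_big; apply: eq_bigr => K _.
under [in RHS]eq_bigr do rewrite mxE; rewrite bigA_distr_bigA mulr_suml.
by apply: eq_bigr => J _; rewrite mulrA big_split.
Qed.

Lemma tact1 T : tact (fun=> 1%:M) T =1 T.
Proof.
move=> I; rewrite /tact (bigD1 I)//= [X in _ + X]big1 => [|K KI]; last first.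
  have [a KIa] : exists a, K a != I a.
    apply/existsP; apply: contraR KI; rewrite negb_exists => /forallP E.
    by apply/eqP/ffunP => a; apply/eqP; have := E a; rewrite negbK.
  by rewrite (bigD1 a)//= mxE eq_sym (negPf KIa) !mul0r.
by rewrite big1 ?mul1r ?addr0// => a _; rewrite mxE eqxx.
Qed.

Definition tpair T S : R := \sum_(I : mindex) T I * S I.

Lemma tpair_tact F T S :
  tpair T (tact F S) = tpair (tact (fun a => (F a)^T) T) S.
Proof.
rewrite /tpair /tact; under eq_bigr do rewrite mulr_sumr.
rewrite exchange_big; apply: eq_bigr => I _; rewrite mulr_suml.
apply: eq_bigr => J _; rewrite mulrCA mulrA; congr (_ * _ * _).
by apply: eq_bigr => a _; rewrite mxE.
Qed.

Lemma tpair_gram E T S :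
  tpair T (tact (fun a => (E a)^T *m E a) S) = tpair (tact E T) (tact E S).
Proof.
rewrite (_ : tpair T _ = tpair T (tact (fun a => (E a)^T) (tact E S))); last first.
  by apply: eq_bigr => I _; rewrite tact_comp.
by rewrite tpair_tact; apply: eq_bigr => I _; congr (_ * _);
   apply: eq_tact => // a; rewrite trmxK.
Qed.

Definition slot (a : 'I_p) (B : 'M[R]_n) : 'I_p -> 'M[R]_n :=
  fun b => if b == a then B else 1%:M.

Definition slot2 (a b : 'I_p) (B C : 'M[R]_n) : 'I_p -> 'M[R]_n :=
  fun c => if c == a then B else if c == b then C else 1%:M.

Lemma upd_id I a : upd I a (I a) = I.
Proof. by apply/ffunP => b; rewrite ffunE; case: eqP => [->|]. Qed.

Lemma upd_same I a k l : upd (upd I a k) a l = upd I a l.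
Proof. by apply/ffunP => b; rewrite !ffunE; case: eqP. Qed.

Lemma tact_slot a B T I : tact (slot a B) T I = \sum_k B (I a) k * T (upd I a k).
Proof.
rewrite /tact (partition_big (fun K : mindex => K a) xpredT)//=.
apply: eq_bigr => k _; rewrite (bigD1 (upd I a k)) ?ffunE ?eqxx//=.
rewrite [X in _ + X]big1 ?addr0 => [|K /andP[/eqP Ka KI]].
  congr (_ * _); rewrite (bigD1 a)//= /slot eqxx ffunE eqxx big1 ?mulr1// => b ba.
  by rewrite (negPf ba) ffunE (negPf ba) mxE eqxx.
have [b /andP[ba KIb]] : exists b, (b != a) && (K b != I b).
  apply/existsP; apply: contraR KI; rewrite negb_exists => /forallP E.
  apply/eqP/ffunP => b; rewrite ffunE; case: (eqVneq b a) => [->//|ba].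
  by apply/eqP; have := E b; rewrite ba negbK.
by rewrite (bigD1 b)//= /slot (negPf ba) mxE eq_sym (negPf KIb) !mul0r.
Qed.

Lemma tact_slot2 a b B C T I : b != a -> tact (slot2 a b B C) T I =
  \sum_k \sum_m B (I a) k * C (I b) m * T (upd (upd I a k) b m).
Proof.
move=> ba; transitivity (tact (slot a B) (tact (slot b C) T) I).
  rewrite tact_comp; apply: eq_tact => // c; rewrite /slot /slot2.
  have [->|_] := eqVneq c a; last by rewrite mul1mx.
  by rewrite eq_sym (negPf ba) mulmx1.
rewrite tact_slot; apply: eq_bigr => k _; rewrite tact_slot mulr_sumr.
by apply: eq_bigr => m _; rewrite ffunE (negPf ba) mulrA.
Qed.

Lemma tact_sum (X : finType) (c : X -> R) F (T : X -> mindex -> R) I :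
  tact F (fun K => \sum_x c x * T x K) I = \sum_x c x * tact F (T x) I.
Proof.
rewrite /tact; under eq_bigr do rewrite mulr_sumr; rewrite exchange_big.
apply: eq_bigr => x _; rewrite mulr_sumr; apply: eq_bigr => K _.
by rewrite mulrCA.
Qed.

(** Overwriting slot [a] forgets its old value, so every multi-index is reached [n] times. This
    allows slicing tensors without multi-indices that lack a slot, at the price of a factor [n]. *)
Lemma sum_upd a (f : mindex -> R) :
  \sum_(I : mindex) \sum_i f (upd I a i) = n%:R * \sum_(I : mindex) f I.
Proof.
rewrite exchange_big /=.
transitivity (\sum_(i < n) \sum_(j < n) \sum_(I : mindex | I a == i) f I).
  apply: eq_bigr => i _; rewrite (partition_big (fun K : mindex => K a) xpredT)//=.
  apply: eq_bigr => j _.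
  (* Overwriting slot [a] is a bijection between the indices with value [j] there and those with
     value [i]. *)
  rewrite (reindex_onto (fun K => upd K a j) (fun K => upd K a i)) /=.
    apply: eq_big => [K|K /andP[_ /eqP <-]].
      rewrite ffunE eqxx eqxx /= upd_same; apply/eqP/eqP => [<-|<-].
        by rewrite ffunE eqxx.
      by rewrite upd_id.
    by rewrite !upd_same.
  by move=> K /eqP Ka; rewrite upd_same -Ka upd_id.
rewrite exchange_big /= (partition_big (fun K : mindex => K a) xpredT)//=.
by rewrite sumr_const card_ord mulr_natl.
Qed.

(** For each [I] the right side is the quadratic form of [B] on the slice of [T] along slot [a],
    where matrix estimates apply. *)
Lemma tpair_slot a B T : n%:R * tpair T (tact (slot a B) T) =
  \sum_(I : mindex) \sum_i \sum_k B i k * (T (upd I a i) * T (upd I a k)).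
Proof.
rewrite /tpair -(sum_upd a); apply: eq_bigr => I _; apply: eq_bigr => i _.
rewrite tact_slot mulr_sumr; apply: eq_bigr => k _.
by rewrite ffunE eqxx upd_same mulrCA.
Qed.

Lemma tpair_slot2 a b B C T : b != a ->
  n%:R * (n%:R * tpair T (tact (slot2 a b B C) T)) =
  \sum_(I : mindex) \sum_i \sum_j \sum_k \sum_l B i k * C j l *
    (T (upd (upd I a i) b j) * T (upd (upd I a k) b l)).
Proof.
move=> ba; rewrite /tpair -(sum_upd b) -(sum_upd a).
apply: eq_bigr => I _; apply: eq_bigr => i _; apply: eq_bigr => j _.
rewrite tact_slot2// mulr_sumr; apply: eq_bigr => k _.
rewrite mulr_sumr; apply: eq_bigr => l _.
rewrite !ffunE !eqxx eq_sym (negPf ba) mulrCA; congr (_ * (_ * T _)).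
by apply/ffunP => d; rewrite !ffunE; case: eqP => // _; case: eqP.
Qed.

Lemma tpair_sumr (X : finType) (P : pred X) T (S : X -> mindex -> R) :
  tpair T (fun I => \sum_(y | P y) S y I) = \sum_(y | P y) tpair T (S y).
Proof.
by rewrite /tpair; under eq_bigr do rewrite mulr_sumr; rewrite exchange_big.
Qed.

Lemma tpairBr T S S' : tpair T (fun I => S I - S' I) = tpair T S - tpair T S'.
Proof.
by rewrite /tpair -sumrB; apply: eq_bigr => I _; rewrite mulrBr.
Qed.

Lemma tpairZr k T S : tpair T (fun I => k * S I) = k * tpair T S.
Proof.
by rewrite /tpair mulr_sumr; apply: eq_bigr => I _; rewrite mulrCA.
Qed.

Lemma eq_tpair T T' S S' : T =1 T' -> S =1 S' -> tpair T S = tpair T' S'.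
Proof. by move=> TT SS; apply: eq_bigr => I _; rewrite TT SS. Qed.

End TensorAction.

Section SymTraceless.
Variables (R : comPzRingType) (n p : nat) (E : 'M[R]_n).
Local Notation mindex := {ffun 'I_p -> 'I_n}.
Variable T : mindex -> R.

Lemma tact_sym : (forall (s : 'S_p) (I : mindex), T [ffun a => I (s a)] = T I) ->
  forall (s : 'S_p) (I : mindex),
    tact (fun=> E) T [ffun a => I (s a)] = tact (fun=> E) T I.
Proof.
move=> Ts s I; rewrite /tact.
rewrite (reindex (fun K : mindex => [ffun a => K (s a)])) /=; last first.
  exists (fun K : mindex => [ffun a => K ((s^-1)%g a)]) => K _; apply/ffunP => a.
    by rewrite !ffunE permKV.
  by rewrite !ffunE permK.
apply: eq_bigr => K _; rewrite Ts; congr (_ * _).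
under eq_bigr do rewrite !ffunE.
by rewrite [RHS](reindex_perm s).
Qed.

(** Summing the rows of [E] in slots [a] and [b] reproduces [Gi], so the frame trace is the
    [Gi]-trace of [T] with [E] acting on the other slots. *)
Lemma tact_traceless (Gi : 'M[R]_n) (a b : 'I_p) : a != b -> Gi = E^T *m E ->
  (forall I : mindex, \sum_k \sum_l Gi k l * T (upd (upd I a k) b l) = 0) ->
  forall I : mindex, \sum_i tact (fun=> E) T (upd (upd I a i) b i) = 0.
Proof.
move=> ab GiE T0 I; have ba : b != a by rewrite eq_sym.
(* [F] acts on the remaining slots, and [D i] puts row [i] of [E] in slots [a] and [b]; its delta
   matrices place that row at [I a] and [I b]. *)
pose F := fun c : 'I_p => if (c == a) || (c == b) then 1%:M else E.
pose D i := slot2 a b (delta_mx (I a) i *m E) (delta_mx (I b) i *m E).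
have DE (i : 'I_n) (x : 'I_n) (y k : 'I_n) :
    (delta_mx x i *m E) y k = (y == x)%:R * E i k.
  rewrite mxE (bigD1 i)//= big1 ?addr0 => [|j ji].
    by rewrite mxE eqxx andbT.
  by rewrite mxE (negPf ji) andbF mul0r.
have step i : tact (fun=> E) T (upd (upd I a i) b i) =
    tact F (tact (D i) T) I.
  transitivity (tact (slot2 a b (delta_mx (I a) i) (delta_mx (I b) i))
      (tact (fun=> E) T) I).
    rewrite tact_slot2// (bigD1 i)//= (bigD1 i)//= !mxE !eqxx !mul1r.
    rewrite !big1 ?addr0// => [j ji|j ji]; last first.
      by rewrite !mxE (negPf ji) andbF mulr0 mul0r.
    by apply: big1 => k _; rewrite !mxE (negPf ji) andbF !mul0r.
  rewrite !tact_comp; apply: eq_tact => // c /=; rewrite /F /D /slot2.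
  have [_|ca] := eqVneq c a; first by rewrite mul1mx.
  by have [_|cb] := eqVneq c b; rewrite mul1mx ?mulmx1.
under eq_bigr do rewrite step -[tact _ _ _]mul1r.
rewrite -tact_sum; apply: big1 => K _ /=.
under [X in _ * X]eq_bigr do rewrite mul1r tact_slot2//.
rewrite (_ : \sum_i _ = 0) ?mulr0//.
transitivity ((K a == I a)%:R * (K b == I b)%:R *
  \sum_k \sum_l Gi k l * T (upd (upd K a k) b l)); last by rewrite T0 mulr0.
rewrite exchange_big mulr_sumr; apply: eq_bigr => k _.
rewrite exchange_big mulr_sumr; apply: eq_bigr => l _.
rewrite GiE mxE mulr_suml mulr_sumr; apply: eq_bigr => i _.
by rewrite !DE !mxE; ring.
Qed.

End SymTraceless.

(** * The pointwise estimate *)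

Section Frame.
Variables (R : realType) (n : nat) (M : topologicalType) (A : manifold R n M).
Variables (g : riem_metric A) (c : idx A) (x : M) (p : nat).
Hypothesis cx : cdom (chart_ c) x.
Local Notation mindex := {ffun 'I_p -> 'I_n}.
Local Notation G := (gmx g c x).
Local Notation Gi := (ginv g c x).

Lemma orthonormal_frame : exists E : 'M[R]_n, E *m G *m E^T = 1%:M.
Proof.
(* Codiagonalization with the zero form as partner. *)
have [||//|E [d [EG _]]] := @posdef_codiag R n G 0; last by exists E.
- exact: g_sym.
- exact: trmx0.
- exact: g_pos.
Qed.

Variable E : 'M[R]_n.
Hypothesis EG : E *m G *m E^T = 1%:M.

Lemma ginv_frame : Gi = E^T *m E.
Proof.
have := mulmx1C EG; rewrite mulmxA => EtEG.
have Gu : G \in unitmx by apply: posdef_unit; exact: (@g_pos _ _ _ _ g c x cx).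
by rewrite /ginv -[LHS]mul1mx -EtEG mulmxK.
Qed.

Lemma tpair_frame (T S : mindex -> R) :
  tpair T (tact (fun=> Gi) S) = tpair (tact (fun=> E) T) (tact (fun=> E) S).
Proof. by rewrite -tpair_gram ginv_frame. Qed.

(** As [Gi = E^T *m E] with [E] invertible, the hypothesis says that [F' a] is [F a] conjugated into
    the frame. *)
Lemma tpair_frame_op (F F' : 'I_p -> 'M[R]_n) (T : mindex -> R) :
  (forall a, Gi *m F a = E^T *m F' a *m E) ->
  tpair T (tact (fun=> Gi) (tact F T)) =
  tpair (tact (fun=> E) T) (tact F' (tact (fun=> E) T)).
Proof.
move=> FF'.
transitivity (tpair T (tact (fun=> E^T) (tact F' (tact (fun=> E) T)))).
  apply: eq_bigr => I _; congr (_ * _).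
  rewrite tact_comp [RHS](eq_tact (fun=> erefl) (tact_comp _ _ _)) tact_comp.
  by apply: eq_tact => // a; rewrite FF' mulmxA.
rewrite tpair_tact; apply: eq_bigr => I _; congr (_ * _).
by apply: eq_tact => // a; rewrite trmxK.
Qed.

(** The curvature tensor in the frame of the rows of [E]. A single sum over quadruples can be
    exchanged with other sums in one step. *)
Definition frame_riem (i j k l : 'I_n) : R :=
  \sum_(q : 'I_n * 'I_n * 'I_n * 'I_n)
    riem g c q.1.1.1 q.1.1.2 q.1.2 q.2 x *
      (E i q.1.1.1 * E j q.1.1.2 * E k q.1.2 * E l q.2).

Lemma sum4E (V : nmodType) (f : 'I_n -> 'I_n -> 'I_n -> 'I_n -> V) :
  \sum_i \sum_j \sum_k \sum_l f i j k l =
  \sum_(q : 'I_n * 'I_n * 'I_n * 'I_n) f q.1.1.1 q.1.1.2 q.1.2 q.2.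
Proof. by rewrite !pair_bigA. Qed.

Lemma prod4_sum (a b d e : 'I_n -> R) :
  (\sum_i a i) * (\sum_i b i) * (\sum_i d i) * (\sum_i e i) =
  \sum_(q : 'I_n * 'I_n * 'I_n * 'I_n) a q.1.1.1 * b q.1.1.2 * d q.1.2 * e q.2.
Proof.
rewrite big_distrlr pair_bigA /= big_distrlr pair_bigA /= big_distrlr pair_bigA.
by [].
Qed.

Lemma biq_frame (X Y : 'rV[R]_n) :
  biq frame_riem (X^T *m X) (Y^T *m Y) = sec g c x (X *m E) (Y *m E).
Proof.
rewrite /biq /sec !sum4E /frame_riem.
under eq_bigr do rewrite -mulrA mulr_suml; rewrite exchange_big.
apply: eq_bigr => q _ /=.
transitivity (riem g c q.1.1.1 q.1.1.2 q.1.2 q.2 x *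
    ((X *m E) 0 q.1.1.1 * (Y *m E) 0 q.1.1.2 * (X *m E) 0 q.1.2 * (Y *m E) 0 q.2));
  last by rewrite !mulrA.
rewrite 4!mxE prod4_sum mulr_sumr; apply: eq_bigr => w _.
rewrite !mxE !big_ord1 !mxE; ring.
Qed.

Lemma frame_riem_diag (X : 'rV[R]_n) : biq frame_riem (X^T *m X) (X^T *m X) = 0.
Proof.
rewrite biq_frame /sec; set Z := X *m E.
(* All four vectors are equal, so swapping the first two summation indices only flips the sign of
   [riem]. *)
set s := \sum_i _; suff ss : s = - s by lra.
rewrite {1}/s exchange_big -sumrN; apply: eq_bigr => i _.
rewrite -sumrN; apply: eq_bigr => j _.
rewrite -sumrN; apply: eq_bigr => k _; rewrite -sumrN; apply: eq_bigr => l _.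
suff -> : riem g c j i k l x = - riem g c i j k l x by ring.
rewrite /riem -sumrN; apply: eq_bigr => m _; rewrite -mulrN; congr (_ * _).
rewrite /curv13 opprD opprB -sumrN; congr (_ + _).
by apply: eq_bigr => q _; rewrite opprB.
Qed.

(** [X *m E] turns Euclidean orthonormal pairs into [g]-orthonormal ones. *)
Lemma frame_riem_pinched (lo hi : R) :
  (forall X Y : 'rV[R]_n, orthonormal_pair g c x X Y -> lo < sec g c x X Y <= hi) ->
  forall X Y : 'rV[R]_n,
    X *m X^T = 1%:M -> Y *m Y^T = 1%:M -> X *m Y^T = 0 ->
    lo < biq frame_riem (X^T *m X) (Y^T *m Y) <= hi.
Proof.
move=> sec_bounds X Y XX YY XY; rewrite biq_frame; apply: sec_bounds.
have gdotE (Z W : 'rV_n) : gdot g c x (Z *m E) (W *m E) = (Z *m W^T) 0 0.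
  rewrite /gdot trmx_mul !mulmxA -(mulmxA Z) -(mulmxA Z (E *m G)) EG.
  by rewrite mulmx1.
by split; rewrite gdotE ?XX ?YY ?XY mxE.
Qed.

End Frame.

(** * The Weitzenböck term in an orthonormal frame *)

Section Weitzenbock.
Variables (R : realType) (n : nat) (M : topologicalType) (A : manifold R n M).
Variables (g : riem_metric A) (c : idx A) (x : M) (p : nat).
Hypothesis cx : cdom (chart_ c) x.
Local Notation mindex := {ffun 'I_p -> 'I_n}.
Local Notation G := (gmx g c x).
Local Notation Gi := (ginv g c x).
Variable E : 'M[R]_n.
Hypothesis EG : E *m G *m E^T = 1%:M.
Local Notation FR := (frame_riem g c x E).

Let ricM := \matrix_(k, l) ricci g c k l x.

Lemma frame_ricci (i k : 'I_n) : (E *m ricM *m E^T) i k = \sum_a FR a i a k.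
Proof.
rewrite /frame_riem exchange_big mxE /=.
under eq_bigr do rewrite !mxE mulr_suml.
transitivity (\sum_l \sum_j \sum_u \sum_m riem g c m j u l x *
   (Gi u m * E i j * E k l)).
  apply: eq_bigr => l _; apply: eq_bigr => j _; rewrite !mxE /ricci.
  rewrite mulr_sumr mulr_suml; apply: eq_bigr => u _.
  by rewrite mulr_sumr mulr_suml; apply: eq_bigr => m _; ring.
rewrite sum4E.
rewrite (reindex (fun q : 'I_n * 'I_n * 'I_n * 'I_n =>
  (q.2, q.1.1.2, q.1.2, q.1.1.1))) /=; last first.
  by exists (fun q => (q.2, q.1.1.2, q.1.2, q.1.1.1)) => -[[[? ?] ?] ?].
apply: eq_bigr => q _; rewrite (ginv_frame cx EG) mxE mulr_suml mulr_suml mulr_sumr.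
by apply: eq_bigr => a _; rewrite !mxE; ring.
Qed.

(** Expanding [riem] over elementary matrices makes the curvature term a combination of two-slot
    actions, to which [tpair_frame_op] applies; the deltas pin the first and third index to [I a]
    and [I b]. *)
Lemma weitzenbockE (phi : tfield A p) :
  weitzenbock g phi c x =1 fun I =>
    \sum_a tact (slot a (ricM *m Gi)) (phi c x) I
    - \sum_a \sum_(b | b != a) \sum_(q : 'I_n * 'I_n * 'I_n * 'I_n)
        riem g c q.1.1.1 q.1.1.2 q.1.2 q.2 x *
        tact (slot2 a b (delta_mx q.1.1.1 q.1.1.2 *m Gi)
                        (delta_mx q.1.2 q.2 *m Gi)) (phi c x) I.
Proof.
have DE (u i : 'I_n) (y k : 'I_n) :
    (delta_mx u i *m Gi) y k = (y == u)%:R * Gi i k.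
  rewrite mxE (bigD1 i)//= big1 ?addr0 => [|j ji].
    by rewrite mxE eqxx andbT.
  by rewrite mxE (negPf ji) andbF mul0r.
move=> I; rewrite /weitzenbock; congr (_ - _).
  apply: eq_bigr => a _; rewrite tact_slot exchange_big; apply: eq_bigr => k _.
  rewrite mxE mulr_suml; apply: eq_bigr => j _; rewrite mxE.
  by congr (_ * _); rewrite mulrC.
apply: eq_bigr => a _; apply: eq_bigr => b ba.
under [RHS]eq_bigr do rewrite tact_slot2//.
rewrite -(@sum4E n R (fun u j w l => riem g c u j w l x * \sum_k \sum_m
  (delta_mx u j *m Gi) (I a) k * (delta_mx w l *m Gi) (I b) m *
  phi c x (upd (upd I a k) b m))).
rewrite [RHS](bigD1 (I a))//= [X in _ + X]big1 ?addr0 => [|u uIa]; last first.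
  rewrite big1// => j _; rewrite big1// => w _; rewrite big1// => l _.
  rewrite big1 ?mulr0// => k _; rewrite big1// => m _.
  by rewrite DE eq_sym (negPf uIa) !mul0r.
apply: eq_bigr => j _; rewrite [LHS]exchange_big.
rewrite [RHS](bigD1 (I b))//= [X in _ + X]big1 ?addr0 => [|w wIb]; last first.
  rewrite big1// => l _.
  rewrite big1 ?mulr0// => k _; rewrite big1// => m _.
  by rewrite !DE [_ == w]eq_sym (negPf wIb) !(mul0r, mulr0).
apply: eq_bigr => l _; rewrite mulr_sumr; apply: eq_bigr => k _.
rewrite mulr_sumr; apply: eq_bigr => m _.
by rewrite !DE !eqxx /=; ring.
Qed.

Variable phi : tfield A p.
Local Notation T := (phi c x).
Let Phi := tact (fun=> E) T.

Hypothesis n_gt1 : (1 < n)%N.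
Variable beta : R.
Hypothesis sec_pinched : forall X Y : 'rV[R]_n, orthonormal_pair g c x X Y ->
  - (n%:R / (n%:R - 1)) * beta < sec g c x X Y <= - beta.
Hypothesis T_sym : forall (s : 'S_p) (I : mindex), T [ffun a => I (s a)] = T I.
Hypothesis T_traceless : forall (a b : 'I_p) (I : mindex), a != b ->
  \sum_k \sum_l Gi k l * T (upd (upd I a k) b l) = 0.

Let FR_pinched := frame_riem_pinched EG sec_pinched.
Let FR_diag := @frame_riem_diag R n M A g c x E.

(** For each slice [v] along slot [a], the matrix [v^T *m v] is positive semidefinite with trace
    [|v|^2], so [pinched_psd] applies. *)
Lemma ricci_pairing_le a : tpair Phi (tact (slot a (E *m ricM *m E^T)) Phi) <=
  - (beta * (n%:R - 1)) * tpair Phi Phi.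
Proof.
have n0 : 0 < n%:R :> R by rewrite ltr0n ltnW.
rewrite -(ler_pM2l n0) tpair_slot mulrCA -(sum_upd a) mulr_sumr.
apply: ler_sum => I _.
pose v : 'rV[R]_n := \row_i Phi (upd I a i).
have := pinched_psd n_gt1 FR_diag FR_pinched (S := v^T *m v).
rewrite trmx_mul trmxK => /(_ erefl); rewrite mulNr.
have -> : \tr (v^T *m v) = \sum_i Phi (upd I a i) * Phi (upd I a i).
  by apply: eq_bigr => i _; rewrite !mxE big_ord1 !mxE.
move=> H; apply: le_trans (H _); last first.
  move=> w; rewrite mulmxA -mulmxA -[w *m v^T]trmxK trmx_mul trmxK mxE.
  by apply: sumr_ge0 => i _; rewrite mxE -expr2 sqr_ge0.
rewrite /biq [leRHS](_ : _ = \sum_i \sum_k (E *m ricM *m E^T) i k *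
  (Phi (upd I a i) * Phi (upd I a k))) //.
rewrite exchange_big /=; apply: eq_bigr => i _.
under eq_bigr do rewrite exchange_big /=.
rewrite exchange_big /=; apply: eq_bigr => k _.
rewrite frame_ricci mulr_suml; apply: eq_bigr => j _.
rewrite (bigD1 j)//= big1 => [|l lj].
  by rewrite !mxE eqxx big_ord1 !mxE addr0 mulr1.
by rewrite !mxE eq_sym (negPf lj) mulr0 mul0r.
Qed.

(** After multiplication by [n^2] the form splits into [biq FR S S] over the slices [S] in slots [a]
    and [b]; these are symmetric by the transposition of [a] and [b], and traceless in the frame. *)
Lemma riem_pairing_ge0 a b : b != a ->
  0 <= \sum_(q : 'I_n * 'I_n * 'I_n * 'I_n) riem g c q.1.1.1 q.1.1.2 q.1.2 q.2 x *
    tpair Phi (tact (slot2 a b (E *m delta_mx q.1.1.1 q.1.1.2 *m E^T)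
                               (E *m delta_mx q.1.2 q.2 *m E^T)) Phi).
Proof.
move=> ba; have ab : a != b by rewrite eq_sym.
have n0 : 0 < n%:R :> R by rewrite ltr0n ltnW.
rewrite -(pmulr_rge0 _ n0) -(pmulr_rge0 _ n0) !mulr_sumr.
have nCA (r t : R) : n%:R * (n%:R * (r * t)) = r * (n%:R * (n%:R * t)) by ring.
under eq_bigr do rewrite nCA tpair_slot2// mulr_sumr.
rewrite exchange_big; apply: sumr_ge0 => I _.
pose S : 'M[R]_n := \matrix_(i, j) Phi (upd (upd I a i) b j).
rewrite [leRHS](_ : _ = biq FR S S).
  apply: (pinched_trace0 n_gt1 FR_diag FR_pinched).
    apply/matrixP => i j; rewrite !mxE -[RHS](tact_sym _ T_sym (tperm a b)).
    congr (Phi _); apply/ffunP => d; rewrite !ffunE.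
    by case: tpermP => [->|->|/eqP da /eqP db];
       rewrite ?eqxx ?(negPf ab) ?(negPf ba) ?(negPf da) ?(negPf db).
  have := tact_traceless ab (ginv_frame cx EG) (fun J => T_traceless J ab) I.
  by apply: etrans; apply: eq_bigr => i _; rewrite mxE.
rewrite /biq sum4E; under eq_bigr do rewrite sum4E mulr_sumr.
rewrite exchange_big /=.
(* The operator produces [FR i k j l * S i j * S k l]; exchanging [j] and [k] gives the index order
   of [biq]. *)
rewrite (reindex (fun q : 'I_n * 'I_n * 'I_n * 'I_n =>
  (q.1.1.1, q.1.2, q.1.1.2, q.2))) /=; last first.
  by exists (fun q => (q.1.1.1, q.1.2, q.1.1.2, q.2)) => -[[[? ?] ?] ?].
apply: eq_bigr => w _.
rewrite /frame_riem -[RHS]mulrA [RHS]mulr_suml; apply: eq_bigr => q _ /=.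
have DE (u j i k : 'I_n) : (E *m delta_mx u j *m E^T) i k = E i u * E k j.
  rewrite mxE (bigD1 j)//= big1 => [|l lj].
    rewrite mxE (bigD1 u)//= big1 => [|l lu]; first by rewrite !mxE !eqxx mulr1 !addr0.
    by rewrite mxE (negPf lu) mulr0.
  by rewrite mxE big1 ?mul0r// => m _; rewrite mxE (negPf lj) andbF mulr0.
rewrite !DE ![S _ _]mxE; ring.
Qed.

Lemma weitzenbock_pairing_le :
  tpair T (tact (fun=> Gi) (weitzenbock g phi c x)) <=
  - (p%:R * beta * (n%:R - 1)) * tpair T (tact (fun=> Gi) T).
Proof.
have GiE := ginv_frame cx EG.
rewrite (tpair_frame cx EG T T) -/Phi; set N := tpair Phi Phi.
(* [Gi] is moved to the left argument so that the right one splits into single operators; [opE] then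
   takes each of them to the frame. *)
rewrite tpair_tact (eq_tpair (fun=> erefl) (weitzenbockE phi)) tpairBr !tpair_sumr.
have opE F F' : (forall a, Gi *m F a = E^T *m F' a *m E) ->
    tpair (tact (fun=> Gi^T) T) (tact F T) = tpair Phi (tact F' Phi).
  by move=> FF'; rewrite -(tpair_frame_op _ FF') [RHS]tpair_tact.
have ric_le : \sum_a tpair (tact (fun=> Gi^T) T) (tact (slot a (ricM *m Gi)) T) <=
    - (p%:R * beta * (n%:R - 1)) * N.
  rewrite [leRHS](_ : _ = \sum_(a < p) - (beta * (n%:R - 1)) * N).
    apply: ler_sum => a _; rewrite (opE _ (slot a (E *m ricM *m E^T))).
      exact: ricci_pairing_le.
    move=> b; rewrite /slot; case: eqP => _; last by rewrite !mulmx1.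
    by rewrite GiE !mulmxA.
  by rewrite sumr_const card_ord -mulr_natl; ring.
rewrite lerBlDr; apply: (le_trans ric_le); rewrite lerDl; apply: sumr_ge0 => a _.
rewrite tpair_sumr; apply: sumr_ge0 => b ba; rewrite tpair_sumr.
under eq_bigr => q _.
  rewrite tpairZr (opE _ (slot2 a b (E *m delta_mx q.1.1.1 q.1.1.2 *m E^T)
                               (E *m delta_mx q.1.2 q.2 *m E^T))); last first.
    move=> d; rewrite /slot2; case: eqP => _; last case: eqP => _.
    - by rewrite GiE !mulmxA.
    - by rewrite GiE !mulmxA.
    - by rewrite mulmx1 GiE mulmx1.
  over.
exact: riem_pairing_ge0.
Qed.

End Weitzenbock.

(** * Contraction of tensor fields *)

Lemma smooth_on_continuous (R : realType) (n : nat) (M : topologicalType)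
    (c : chart R n M) (f : M -> R^o) (x : M) :
  cdom c x -> smooth_on c (cdom c) f -> {for x, continuous f}.
Proof.
move=> cx /(_ 0%N)[/(_ (crd c x)) cont _].
have fE : ((f \o crdV c) \o crd c) x = f x by rewrite /= crdK.
have {}cont : {for crd c x, continuous (f \o crdV c)} by apply: cont; exists x.
have := continuous_comp (crd_cont cx) cont; rewrite /prop_for /continuous_at fE.
apply: cvg_trans; apply: near_eq_cvg.
have : nbhs x (cdom c) by apply: open_nbhs_nbhs; split => //; exact: cdom_open.
by apply: filterS => y cy /=; rewrite crdK.
Qed.

Section Continuity.
Variables (R : realType) (M : topologicalType) (x : M).

Lemma continuous_at_sum (I : finType) (f : I -> M -> R) :
  (forall i, {for x, continuous (f i)}) ->
  {for x, continuous (fun y => \sum_i f i y)}.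
Proof.
move=> fc; apply: cvg_big => [z|i _]; last exact: fc.
exact: (cvgD cvg_fst cvg_snd).
Qed.

Lemma continuous_at_prod (I : finType) (f : I -> M -> R) :
  (forall i, {for x, continuous (f i)}) ->
  {for x, continuous (fun y => \prod_i f i y)}.
Proof.
move=> fc; apply: cvg_big => [z|i _]; last exact: fc.
exact: (cvgM cvg_fst cvg_snd).
Qed.

Lemma continuous_at_det n (F : M -> 'M[R]_n) :
  (forall i j, {for x, continuous (fun y => F y i j)}) ->
  {for x, continuous (fun y => \det (F y))}.
Proof.
move=> Fc; apply: continuous_at_sum => s.
apply: continuousM; first exact: cst_continuous.
exact: continuous_at_prod.
Qed.

Lemma continuous_at_invmx n (F : M -> 'M[R]_n) i j :
  (forall i j, {for x, continuous (fun y => F y i j)}) -> F x \in unitmx ->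
  {for x, continuous (fun y => invmx (F y) i j)}.
Proof.
move=> Fc Fu; have detF := continuous_at_det Fc.
have dx : \det (F x) != 0 by rewrite -unitfE -unitmxE.
(* The cofactor formula agrees with [invmx] where the determinant is nonzero, hence near [x]; at
   singular matrices [invmx] returns its argument. *)
pose h y := (\det (F y))^-1 * ((-1) ^+ (j + i) * \det (row' j (col' i (F y)))).
have hE y : \det (F y) != 0 -> invmx (F y) i j = h y.
  by move=> dy; rewrite /invmx unitmxE unitfE dy !mxE.
have hc : {for x, continuous h}.
  apply: continuousM; first exact: continuousV.
  apply: continuousM; first exact: cst_continuous.
  apply: continuous_at_det => k l.
  rewrite (_ : (fun y => _) = (fun y => F y (lift j k) (lift i l))) //.
  by apply/funext => y; rewrite !mxE.
move: hc; rewrite /prop_for /continuous_at -(hE x)//.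
apply: cvg_trans; apply: near_eq_cvg.
have : \forall y \near x, \det (F y) != 0.
  exact: cvgr_neq0 detF dx.
by apply: filterS => y /hE ->.
Qed.

End Continuity.

Section Contraction.
Variables (R : realType) (n : nat) (M : topologicalType) (A : manifold R n M).
Variables (g : riem_metric A) (p : nat).
Local Notation mindex := {ffun 'I_p -> 'I_n}.
Implicit Types (c : idx A) (x : M) (T S : tfield A p).

(** [tdot] picks a chart at each point with no continuity in the choice; with the chart fixed,
    continuity can be proved. *)
Definition contraction c T S x : R :=
  tpair (T c x) (tact (fun=> ginv g c x) (S c x)).

Lemma tdotE T S x : tdot g T S x = contraction (chart_at A x) T S x.
Proof.
rewrite /tdot /contraction /tpair; apply: eq_bigr => I _.
rewrite /tact mulr_sumr; apply: eq_bigr => J _; rewrite mulrCA mulrA; congr (_ * _).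
Qed.

Lemma chart_atP x : cdom (chart_ (chart_at A x)) x.
Proof. exact: projT2 (cid (chart_cover A x)). Qed.

Lemma contraction_ge0 c T x : cdom (chart_ c) x -> 0 <= contraction c T T x.
Proof.
move=> cx; have [E EG] := orthonormal_frame g cx.
rewrite /contraction (tpair_frame cx EG) sumr_ge0// => I _.
by rewrite -expr2 sqr_ge0.
Qed.

Lemma contraction_gt0 c T x : cdom (chart_ c) x -> T c x <> 0 ->
  0 < contraction c T T x.
Proof.
move=> cx Tx; rewrite lt_neqAle contraction_ge0// andbT eq_sym.
apply/negP => /eqP; have [E EG] := orthonormal_frame g cx.
rewrite /contraction (tpair_frame cx EG) => /psumr_eq0P TE; apply: Tx.
have E0 I : tact (fun=> E) (T c x) I = 0.
  have := TE _ I isT; rewrite -expr2 => H; apply/eqP; rewrite -sqrf_eq0.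
  by apply/eqP; apply: H => J _; rewrite -expr2 sqr_ge0.
apply/funext => I; rewrite -(tact1 (T c x) I).
(* [G *m E^T] is the inverse of [E], so [T] is recovered from its vanishing frame components. *)
transitivity (tact (fun=> gmx g c x *m E^T) (tact (fun=> E) (T c x)) I).
  rewrite tact_comp; apply: eq_tact => // a.
  by rewrite [RHS](mulmx1C (A := E))// mulmxA.
by apply: big1 => K _; rewrite E0 mulr0.
Qed.

Lemma contraction_chart c c' T S x : smooth_section T -> smooth_section S ->
  cdom (chart_ c) x -> cdom (chart_ c') x ->
  contraction c T S x = contraction c' T S x.
Proof.
move=> [_ _ Tt] [_ _ St] cx c'x; pose J := jac c c' x.
have TE I : T c x I = tact (fun=> J^T) (T c' x) I.
  rewrite (Tt c c' x cx c'x); apply: eq_bigr => K _; congr (_ * _).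
  by apply: eq_bigr => a _; rewrite [RHS]mxE.
have SE I : S c x I = tact (fun=> J^T) (S c' x) I.
  rewrite (St c c' x cx c'x); apply: eq_bigr => K _; congr (_ * _).
  by apply: eq_bigr => a _; rewrite [RHS]mxE.
have Gu : gmx g c x \in unitmx by apply: posdef_unit; exact: g_pos.
have G'u : gmx g c' x \in unitmx by apply: posdef_unit; exact: g_pos.
have GJ := g_tensor g cx c'x; rewrite -/J in GJ.
(* Read off from [G = J^T G' J], whose left side is invertible. *)
have Ju : J \in unitmx.
  by move: Gu; rewrite GJ !unitmx_mul unitmx_tr => /andP[/andP[]].
have JG : J *m ginv g c x *m J^T = ginv g c' x.
  apply: (can_inj (mulmxK G'u)); rewrite /ginv mulVmx//.
  apply: (can_inj (mulmxK Ju)).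
  by rewrite mul1mx -!mulmxA [J^T *m _]mulmxA -GJ mulVmx// mulmx1.
transitivity (tpair (tact (fun=> J^T) (T c' x))
    (tact (fun=> ginv g c x *m J^T) (S c' x))).
  apply: eq_tpair => // I; rewrite -tact_comp.
  exact: eq_tact.
rewrite -[LHS](tpair_tact (fun=> J)); apply: eq_tpair => // I.
by rewrite tact_comp; apply: eq_tact => // a; rewrite mulmxA JG.
Qed.

Lemma ginv_continuous c x i j : cdom (chart_ c) x ->
  {for x, continuous (fun y => ginv g c y i j)}.
Proof.
move=> cx; apply: continuous_at_invmx; last by apply: posdef_unit; exact: g_pos.
by move=> k l; apply: smooth_on_continuous cx _; exact: g_smooth.
Qed.

Lemma contraction_continuous c T S x : smooth_section T -> smooth_section S ->
  cdom (chart_ c) x -> {for x, continuous (contraction c T S)}.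
Proof.
move=> [_ Tc _] [_ Sc _] cx; apply: continuous_at_sum => I.
apply: continuousM; first exact: smooth_on_continuous cx (Tc c I).
apply: continuous_at_sum => J.
apply: continuousM; last exact: smooth_on_continuous cx (Sc c J).
by apply: continuous_at_prod => a; exact: ginv_continuous.
Qed.

End Contraction.

(** * Positivity of the L^2 pairing *)

(** The integral of a nonnegative function is a supremum over simple functions below it, and [e]
    times the indicator of [U] is one of them; measurability of [f] is not assumed. *)
Lemma integral_ge_measure d (T : measurableType d) (R : realType)
    (mu : {measure set T -> \bar R}) (f : T -> \bar R) (U : set T) (e : R) :
  measurable U -> 0 <= e -> (forall x, 0 <= f x)%E ->
  (forall x, U x -> e%:E <= f x)%E -> (e%:E * mu U <= \int[mu]_x f x)%E.
Proof.
move=> mU e0 f0 fU; rewrite ge0_integralTE//.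
rewrite -(sintegral_indic mu U) -(sintegralrM mu e (indic_nnsfun R mU)).
apply: ereal_sup_ubound; exists (scale_nnsfun (indic_nnsfun R mU) e0) => //= x.
rewrite measurable_realfun.mindicE.
have [xU|xU] := boolP (x \in U); last by rewrite mulr0.
by rewrite mulr1; apply: fU; exact: set_mem.
Qed.

Lemma borel_open (T : ptopologicalType) (U : set T) :
  open U -> measurable (U : set (borel T)).
Proof. by move=> oU; apply: sub_sigma_algebra. Qed.

Lemma borel_box (R : realType) n (a b : 'rV[R]_n) :
  measurable ([set y : 'rV[R]_n | forall i, a 0 i < y 0 i <= b 0 i]
              : set (borel 'rV[R]_n)).
Proof.
have half_open (i : 'I_n) r :
    measurable ([set y : 'rV[R]_n | r < y 0 i] : set (borel 'rV[R]_n)).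
  apply: borel_open.
  rewrite (_ : [set _ | _] = (fun y : 'rV[R]_n => y 0 i) @^-1` [set s | r < s])//.
  by apply: open_comp => [y _|]; [exact: coord_continuous|exact: open_gt].
rewrite (_ : [set _ | _] = \bigcap_(i in [set: 'I_n])
  ([set y : 'rV[R]_n | a 0 i < y 0 i] `&` ~` [set y : 'rV[R]_n | b 0 i < y 0 i])).
  apply: fin_bigcap_measurable => // i _.
  by apply: measurableI => //; exact: measurableC.
apply/seteqP; split=> y yab i.
  by move=> _; have /andP[? ?] := yab i; split=> //=; apply/negP; rewrite -leNgt.
by have [//= ay /negP] := yab i I; rewrite -leNgt ay => ->.
Qed.


Section Volume.
Variables (R : realType) (n : nat) (M : ptopologicalType) (A : manifold R n M).
Variables (g : riem_metric A) (vol : {measure set (borel M) -> \bar R}).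
Hypothesis hvol : riemannian_volume g vol.

(** Near [x] the density [sqrt (det g)] stays above a positive constant, and the chart image
    contains a box of positive Lebesgue measure. [B] lies in one chart domain, where [vol] has its
    explicit formula. *)
Lemma volume_open_gt0 (W : set M) (x : M) : open W -> W x ->
  exists B : set M, [/\ open B, B `<=` W & (0 < vol B)%E].
Proof.
move=> oW Wx; have [lam [lamP volP]] := hvol.
pose c := chart_at A x; have cx := chart_atP A x; rewrite -/c in cx.
pose K := chart_ c; pose y0 := crd K x.
have Yy0 : (crd K @` cdom K) y0 by exists x.
pose dG (y : 'rV[R]_n) : R := \det (gmx g c (crdV K y)).
have dG0 : 0 < dG y0.
  rewrite /dG crdK//; have [E EG] := orthonormal_frame g cx.
  have := congr1 determinant EG; rewrite !det_mulmx det_tr det1 => d1.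
  have dE : \det E != 0.
    by apply: contra_eq_neq d1 => ->; rewrite !mul0r eq_sym oner_eq0.
  have : 0 < \det E ^+ 2 * \det (gmx g c x) by rewrite expr2 mulrAC d1.
  by rewrite pmulr_rgt0// exprn_even_gt0.
have dGc : {for y0, continuous dG}.
  by apply: continuous_at_det => i j; have [+ _] := g_smooth g c i j 0%N; exact.
have [e e0 eP] : exists2 e : R, 0 < e & forall y, ball y0 e y ->
    [/\ (crd K @` cdom K) y, W (crdV K y) & dG y0 / 2 < dG y].
  have : \forall y \near y0,
      [/\ (crd K @` cdom K) y, W (crdV K y) & dG y0 / 2 < dG y].
    near=> y; split; near: y.
    - by apply: open_nbhs_nbhs; split=> //; exact: img_open.
    - apply: (crdV_cont Yy0); rewrite crdK//; exact: open_nbhs_nbhs.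
    - by apply: (cvgr_gt _ dGc); lra.
  by move=> /nbhs_ballP[e /= e0 eP]; exists e.
pose B := cdom K `&` (crd K @^-1` ball y0 e).
have oB : open B.
  rewrite openE => z [Kz ez]; apply: filterI.
    by apply: open_nbhs_nbhs; split=> //; exact: cdom_open.
  apply: (crd_cont Kz); apply: open_nbhs_nbhs; split=> //.
  exact: ball_open.
exists B; split=> //.
  by move=> z [Kz /eP[_ + _]]; rewrite crdK.
have crdB : crd K @` B = ball y0 e.
  apply/seteqP; split=> [_ [z [_ ?] <-//]|y ye].
  have [[z Kz zy] _ _] := eP y ye.
  by exists z => //; split=> //; rewrite /preimage /= zy.
rewrite (volP c B)//; last 2 first.
- exact: borel_open.
- by move=> z [].
(* Extending the density by 0 outside the ball allows [integral_ge_measure] to be applied with the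
   box as [U]. *)
rewrite [X in (\int[_]_(_ in X) _)%E]crdB integral_mkcond.
(* Half-open, as in [is_lebesgue]; the half-width [e / 2] keeps the closed faces inside the open
   ball. *)
pose box : set 'rV[R]_n := [set y | forall i, (y0 - const_mx (e / 2)) 0 i < y 0 i
  <= (y0 + const_mx (e / 2)) 0 i].
have box_ball : box `<=` ball y0 e.
  move=> y boxy; split=> // i j; rewrite ord1.
  have := boxy j; rewrite !mxE => /andP[? ?].
  by rewrite /ball /= ltr_norml; apply/andP; split; lra.
pose r := Num.sqrt (dG y0 / 2).
have r0 : 0 < r by rewrite sqrtr_gt0; lra.
apply: (@lt_le_trans _ _ (r%:E * lam box)%E).
  rewrite lamP => [|i]; last by rewrite !mxE; lra.
  rewrite -EFinM lte_fin mulr_gt0// prodr_gt0// => i _; rewrite !mxE; lra.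
apply: integral_ge_measure; [exact: borel_box|exact: ltW| |].
  by move=> y; rewrite erestrict_ge0// => z _; rewrite lee_fin sqrtr_ge0.
move=> y boxy; rewrite patchE mem_set; last exact: box_ball.
have [_ _ dGy] := eP y (box_ball _ boxy).
by rewrite lee_fin ler_wsqrtr// ltW.
Unshelve. all: by end_near. Qed.

(** By continuity the integrand exceeds half its value at [x] on an open set, which contains a set
    of positive volume. The factor [s] serves both signs of the pairing. *)
Lemma integral_tdot_gt0 p (s : R) (T S : tfield A p) (c : idx A) (x : M) :
  smooth_section T -> smooth_section S -> (forall y, 0 <= s * tdot g T S y) ->
  cdom (chart_ c) x -> 0 < s * contraction g c T S x ->
  (0 < \int[vol]_y (s * tdot g T S y)%:E)%E.
Proof.
move=> Ts Ss TS0 cx TSx; set e := s * contraction g c T S x / 2.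
have e0 : 0 < e by rewrite /e; lra.
have : nbhs x [set y | cdom (chart_ c) y /\ e < s * contraction g c T S y].
  near=> y; split; near: y.
    by apply: open_nbhs_nbhs; split=> //; exact: cdom_open.
  have := continuousM (@cst_continuous M R s x)
    (contraction_continuous (g := g) Ts Ss cx).
  by move=> sc; apply: (cvgr_gt _ sc); rewrite /e /=; lra.
rewrite nbhsE => -[W [oW Wx] Wsub].
have [B [oB BW volB]] := volume_open_gt0 oW Wx.
apply: (@lt_le_trans _ _ (e%:E * vol B)%E); first by rewrite mule_gt0.
apply: integral_ge_measure; [exact: borel_open|exact: ltW| |].
  by move=> y; rewrite lee_fin.
move=> y /BW/Wsub[cy /ltW ey]; rewrite lee_fin tdotE.
by rewrite (contraction_chart g Ts Ss (chart_atP A y) cy).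
Unshelve. all: by end_near. Qed.

End Volume.

(** * The kernel *)

Lemma Ck_cst0 (R : realType) n k (U : set 'rV[R]_n) : Ck k U (fun=> 0).
Proof.
have cont0 y : U y -> {for y, continuous (fun=> 0 : R^o)}.
  by move=> _; exact: cst_continuous.
elim: k => [|k IHk] /=; first by split.
split=> // i.
split=> [y _|]; first exact: derivable_cst.
rewrite (_ : (fun y => _) = fun=> 0)//.
by apply/funext => y; rewrite derive_cst.
Qed.

Section ZeroTensor.
Variables (R : realType) (n : nat) (M : topologicalType) (A : manifold R n M).
Variables (g : riem_metric A) (p : nat).
Implicit Types (c : idx A) (x : M) (T : tfield A p).

Lemma smooth_section_neq0 T : smooth_section T -> T <> 0 ->
  exists c x, cdom (chart_ c) x /\ T c x <> 0.
Proof.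
move=> [T0 _ _] TN0; apply: contrapT => H; apply: TN0.
apply/funext => c; apply/funext => x; have [cx|/T0//] := pselect (cdom (chart_ c) x).
by apply: contrapT => Tx; apply: H; exists c, x.
Qed.

Lemma sym_traceless0 : sym_traceless g (0 : tfield A p).
Proof.
split=> [|//|c x _ a b I _]; last first.
  by apply: big1 => k _; apply: big1 => l _; rewrite mulr0.
split=> // [c I k|c c' x _ _ I]; first exact: Ck_cst0.
by rewrite big1// => K _; rewrite mulr0.
Qed.

Lemma nabla0 : nabla g (0 : tfield A p) = 0.
Proof.
apply/funext => c; apply/funext => x; apply/funext => K; rewrite /nabla.
case: pselect => // cx; rewrite (_ : pd _ _ _ _ = 0); last exact: derive_cst.
rewrite sub0r big1 ?oppr0// => a _; rewrite big1// => m _; exact: mulr0.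
Qed.

Lemma weitzenbock0 : weitzenbock g (0 : tfield A p) = 0.
Proof.
apply/funext => c; apply/funext => x; apply/funext => I; rewrite /weitzenbock.
rewrite big1 => [|a _].
  rewrite sub0r big1 ?oppr0// => a _; rewrite big1// => b _; rewrite big1// => j _.
  rewrite big1// => k _; rewrite big1// => l _; rewrite big1// => m _.
  exact: mulr0.
by rewrite big1// => j _; rewrite big1// => k _; exact: mulr0.
Qed.

Lemma tdot0r T x : tdot g T 0 x = 0.
Proof.
by rewrite /tdot big1// => I _; rewrite big1// => J _; exact: mulr0.
Qed.

End ZeroTensor.

Section Vanishing.
Variables (R : realType) (n : nat) (M : ptopologicalType) (A : manifold R n M).
Variables (g : riem_metric A) (vol : {measure set (borel M) -> \bar R}).
Hypothesis hvol : riemannian_volume g vol.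
Variable p : nat.

(** Testing an adjoint [psi] of the zero field on [psi] itself gives [<psi, psi> = 0], whereas a
    nonzero [psi] has positive norm. *)
Lemma nabla_star0 : nabla_star g vol (0 : tfield A p.+1) = 0.
Proof.
rewrite /nabla_star; case: xgetP => // psi _ [psi_st psiP].
apply: contrapT => psi0; have [psi_s _ _] := psi_st.
have [c [x [cx psix]]] := smooth_section_neq0 psi_s psi0.
have := integral_tdot_gt0 hvol (s := 1) psi_s psi_s _ cx _.
have psi_ge0 y : 0 <= 1 * tdot g psi psi y.
  by rewrite mul1r tdotE contraction_ge0//; exact: chart_atP.
rewrite mul1r => /(_ psi_ge0 (contraction_gt0 g cx psix)).
under eq_integral do rewrite mul1r.
rewrite -/(l2dot g vol psi psi) (psiP _ psi_st) /l2dot integral0_eq ?ltxx//.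
by move=> y _; rewrite tdot0r.
Qed.

Lemma ker_sampson0 : ker_sampson g vol p 0.
Proof.
split; first exact: sym_traceless0.
by rewrite /sampson_laplacian /rough_laplacian nabla0 nabla_star0 weitzenbock0 subr0.
Qed.

Lemma ker_sampson_eq0 (beta : R) (hn : (1 < n)%N) (hp : (0 < p)%N) :
  0 < beta ->
  (forall (c : idx A) (x : M), cdom (chart_ c) x ->
     forall X Y : 'rV[R]_n, orthonormal_pair g c x X Y ->
       - (n%:R / (n%:R - 1)) * beta < sec g c x X Y <= - beta) ->
  forall phi, ker_sampson g vol p phi -> phi = 0.
Proof.
move=> beta0 hsec phi [phi_st /eqP]; rewrite subr_eq0 => /eqP phiW.
have [phi_s phi_sym phi_tr] := phi_st.
have pair_le c x : cdom (chart_ c) x ->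
    contraction g c phi (weitzenbock g phi) x <=
    - (p%:R * beta * (n%:R - 1)) * contraction g c phi phi x.
  move=> cx; have [E EG] := orthonormal_frame g cx.
  exact: (weitzenbock_pairing_le cx EG hn (hsec c x cx) (phi_sym c x cx) (phi_tr c x cx)).
have k0 : 0 < p%:R * beta * (n%:R - 1).
  by rewrite !mulr_gt0 ?ltr0n// subr_gt0 ltr1n.
have pair_lt c x : cdom (chart_ c) x -> phi c x <> 0 ->
    contraction g c phi (weitzenbock g phi) x < 0.
  move=> cx phix; apply: le_lt_trans (pair_le c x cx) _.
  by rewrite mulNr oppr_lt0 mulr_gt0// contraction_gt0.
apply: contrapT => phi0; have [c [x [cx phix]]] := smooth_section_neq0 phi_s phi0.
have := pair_lt c x cx phix; move: pair_le; rewrite -phiW /rough_laplacian /nabla_star.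
(* Without an adjoint, the default 0 replaces the Weitzenböck term, and the pairing at [x] would be
   0 instead of negative. *)
case: xgetP => [psi _ [[psi_s _ _] psiP]|_] pair_le pairx; last first.
  move: pairx; rewrite /contraction /tpair big1 ?ltxx// => I _.
  by rewrite /tact big1 ?mulr0// => K _; exact: mulr0.
have tdot_le0 y : 0 <= -1 * tdot g phi psi y.
  rewrite mulN1r oppr_ge0 tdotE; have cy := chart_atP A y.
  apply: le_trans (pair_le _ _ cy) _.
  by rewrite mulNr oppr_le0 mulr_ge0 ?(ltW k0) ?contraction_ge0.
(* Negativity at [x] makes [<phi, psi>] negative, while testing the adjoint on [phi] gives the
   squared norm of [nabla g phi]. *)
have := integral_tdot_gt0 hvol (s := -1) phi_s psi_s tdot_le0 cx.
rewrite mulN1r oppr_gt0 => /(_ pairx) int_gt0.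
have : (0 <= l2dot g vol phi psi)%E.
  rewrite psiP//; apply: integral_ge0 => y _.
  by rewrite lee_fin tdotE contraction_ge0//; exact: chart_atP.
apply/negP; rewrite -ltNge /l2dot.
rewrite (_ : (fun y => _) = fun y => (- (-1 * tdot g phi psi y)%:E)%E); last first.
  by apply/funext => y; rewrite -EFinN mulN1r opprK.
by rewrite integral_ge0N ?oppe_lt0// => y _; rewrite lee_fin.
Qed.

End Vanishing.

Theorem theorem4 (R : realType) (n : nat) (hn : (2 <= n)%N)
    (M : ptopologicalType) (A : manifold R n M) (g : riem_metric A)
    (vol : {measure set (borel M) -> \bar R})
    (hvol : riemannian_volume g vol)
    (hcompact : compact [set: M]) (hconnected : connected [set: M])
    (beta : R) (hbeta : 0 < beta)
    (hsec : forall (c : idx A) (x : M), cdom (chart_ c) x ->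
       forall X Y : 'rV[R]_n, orthonormal_pair g c x X Y ->
         - (n%:R / (n%:R - 1)) * beta < sec g c x X Y <= - beta)
    (p : nat) (hp : (2 <= p)%N) :
  has_dim (ker_sampson g vol p) 0.
Proof.
(* The basis is the empty family, with span [{0}]; equality with the kernel also requires that 0
   lies in it. *)
exists (fun=> 0); split=> [a _ []//|].
apply/seteqP; split=> [phi phiK|phi [a ->]] /=.
  by exists (fun=> 0); rewrite big_ord0; exact: ker_sampson_eq0 (ltnW hp) _ hsec _ phiK.
by rewrite big_ord0; exact: ker_sampson0.
Qed.
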